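(* Let $\Delta$ be a finite simplicial complex with vertices $A_1,\ldots,A_N$, let $X=\bigcup_iT_i$ be the union of the faces $T_i$ of the simplex $T$ corresponding to the vertices $A_i$ of $\Delta$, and let $Y=\bigcup_iL_{T_i}$ be the union of their affine hulls. Then the nerve of the covering of $X$ by the $T_i$ is naturally identified with the nerve of the covering of $Y$ by the $L_{T_i}$, and both of these nerves are naturally identified with the original simplicial complex $\Delta$. (The natural identifications are those given on vertices by $T_i\leftrightarrow L_{T_i}\leftrightarrow A_i$.)
   Context: Let $\Delta'$ be the barycentric subdivision of $\Delta$; its vertices $A_\sigma$ correspond to the nonempty simplices $\sigma$ of $\Delta$. Choose affinely independent points in a real vector space $L$, identified with the vertices $A_\sigma$ of $\Delta'$, and let $T\subset L$ be the simplex they span. For a vertex $A_i$ of $\Delta$, $T_i$ is the face of $T$ that is the convex hull of all $A_\sigma$ with $\sigma$ a simplex of $\Delta$ having $A_i$ as a vertex, and $L_{T_i}$ is the affine hull of $T_i$. The nerve of a covering $\{X_i\}$ is the simplicial complex with one vertex for each index $i$, in which $i_1,\ldots,i_k$ span a simplex if and only if $X_{i_1}\cap\cdots\cap X_{i_k}\ne\varnothing$. *)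

(* Defs.v *)
From mathcomp Require Export all_boot all_order all_algebra.
From mathcomp Require Export boolp classical_sets reals.

Set Implicit Arguments.
Unset Strict Implicit.
Unset Printing Implicit Defensive.

Import Order.TTheory GRing.Theory Num.Theory.

Local Open Scope ring_scope.
Local Open Scope classical_set_scope.

(* Simplices are the nonempty ones: the empty face is never counted, neither
   in a complex nor in a nerve. *)
Record simplicial_complex := SimplicialComplex {
  vertex : finType;
  simplices : {set {set vertex}};
  simplices_neq0 : finset.set0 \notin simplices;
  simplices_vertex : forall v : vertex, [set v]%SET \in simplices;
  simplices_down : forall s t : {set vertex}, s != finset.set0 ->
    s \subset t -> t \in simplices -> s \in simplices }.

Definition simplicial_iso (K K' : simplicial_complex)
    (f : vertex K -> vertex K') :=
  bijective f /\
  forall s : {set vertex K}, (s \in simplices K) = (f @: s \in simplices K').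

Section Barycentric.
Variable K : simplicial_complex.

Definition barycenter : finType := {s : {set vertex K} | s \in simplices K}.

Definition flags : {set {set barycenter}} :=
  [set C : {set barycenter} | (C != finset.set0) &&
    [forall s in C, forall t in C,
      (val s \subset val t) || (val t \subset val s)]]%SET.

Fact flags_neq0 : finset.set0 \notin flags.
Proof. by rewrite inE eqxx. Qed.

Fact flags_vertex (s : barycenter) : [set s]%SET \in flags.
Proof.
rewrite inE; apply/andP; split; first by apply/set0Pn; exists s; rewrite inE.
apply/forall_inP => x /set1P ->; apply/forall_inP => y /set1P ->.
by rewrite subxx.
Qed.

Fact flags_down (C D : {set barycenter}) : C != finset.set0 ->
  C \subset D -> D \in flags -> C \in flags.
Proof.
move=> C0 /fintype.subsetP CD; rewrite !inE C0 => /andP[_ /forall_inP flD] /=.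
apply/forall_inP => s /CD sD; apply/forall_inP => t /CD tD.
exact: (forall_inP (flD s sD)).
Qed.

Definition barycentric : simplicial_complex :=
  SimplicialComplex flags_neq0 flags_vertex flags_down.

(* The barycenters A_s of the simplices s having v as a vertex. *)
Definition star (v : vertex K) : set (vertex barycentric) :=
  [set s : barycenter | v \in val s].

End Barycentric.

Section Hulls.
Variables (R : realType) (L : lmodType R).

Definition convex_hull (S : set L) : set L :=
  [set x | exists (n : nat) (c : 'I_n -> R) (y : 'I_n -> L),
    [/\ forall i, S (y i), forall i, 0 <= c i, \sum_i c i = 1
      & x = \sum_i c i *: y i]].

Definition affine_hull (S : set L) : set L :=
  [set x | exists (n : nat) (c : 'I_n -> R) (y : 'I_n -> L),
    [/\ forall i, S (y i), \sum_i c i = 1 & x = \sum_i c i *: y i]].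

Definition affinely_independent (I : finType) (p : I -> L) :=
  forall c : I -> R, \sum_i c i = 0 -> \sum_i c i *: p i = 0 ->
  forall i, c i = 0.

Lemma sub_convex_hull (S : set L) : S `<=` convex_hull S.
Proof.
move=> x Sx; exists 1%N, (fun=> 1), (fun=> x).
by split=> //; rewrite big_ord1 // scale1r.
Qed.

Lemma sub_affine_hull (S : set L) : S `<=` affine_hull S.
Proof.
move=> x Sx; exists 1%N, (fun=> 1), (fun=> x).
by split=> //; rewrite big_ord1 // scale1r.
Qed.

End Hulls.

(* The members are required to be nonempty, so that the nerve has one vertex
   for each index. *)
Record covering (T : Type) (X : set T) (I : finType) := Covering {
  member :> I -> set T;
  member_neq0 : forall i, member i !=set0;
  member_cover : \bigcup_(i in setT) member i = X }.

Section Nerve.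
Variables (T : Type) (X : set T) (I : finType) (F : covering X I).

Definition nerve_simplices : {set {set I}} :=
  [set s : {set I} | (s != finset.set0) &&
    `[< \bigcap_(i in [set` s]) F i !=set0 >]]%SET.

Fact nerve_neq0 : finset.set0 \notin nerve_simplices.
Proof. by rewrite inE eqxx. Qed.

Fact nerve_vertex (i : I) : [set i]%SET \in nerve_simplices.
Proof.
rewrite inE; apply/andP; split; first by apply/set0Pn; exists i; rewrite inE.
apply/asboolP; have [x Fx] := member_neq0 F i.
by exists x => j /= /set1P ->.
Qed.

Fact nerve_down (s t : {set I}) : s != finset.set0 ->
  s \subset t -> t \in nerve_simplices -> s \in nerve_simplices.
Proof.
move=> s0 /fintype.subsetP st; rewrite !inE s0 => /andP[_ /asboolP[x Fx]] /=.
by apply/asboolP; exists x => i /= /st; exact: Fx.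
Qed.

Definition nerve : simplicial_complex :=
  SimplicialComplex nerve_neq0 nerve_vertex nerve_down.

End Nerve.

Section Faces.
Variables (R : realType) (L : lmodType R) (K : simplicial_complex).
Variable p : vertex (barycentric K) -> L.
Variables (N : nat) (A : 'I_N -> vertex K).

(* The face of the simplex with vertices p whose vertices are indexed by J;
   the whole simplex is [simplex_face setT]. *)
Definition simplex_face (J : set (vertex (barycentric K))) : set L :=
  convex_hull (p @` J).

Definition face (i : 'I_N) : set L := simplex_face (star (A i)).

Definition face_span (i : 'I_N) : set L := affine_hull (face i).

Fact face_nonempty i : face i !=set0.
Proof.
exists (p (exist _ [set A i]%SET (simplices_vertex (A i)))).
apply: sub_convex_hull; eexists; last by reflexivity.
by rewrite /star /= inE.
Qed.

Fact face_span_nonempty i : face_span i !=set0.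
Proof.
by have [x ix] := face_nonempty i; exists x; exact: sub_affine_hull.
Qed.

Definition face_union : set L := \bigcup_(i in setT) face i.

Definition span_union : set L := \bigcup_(i in setT) face_span i.

Definition face_covering : covering face_union 'I_N :=
  Covering face_nonempty erefl.

Definition span_covering : covering span_union 'I_N :=
  Covering face_span_nonempty erefl.

End Faces.

(* Main.v *)
Require Import Defs.

(** The theorem amounts to a cycle of implications between three conditions on
    a set [s] of indices.

    If the vertices [A i], [i \in s], span a simplex [sigma] of [Delta], then
    the point [p sigma] is a vertex of every [T_i] with [i \in s], so these
    faces meet ([nerve_face_of_simplex]).  If the faces meet, so do their
    affine hulls, which contain them ([nerve_span_of_face]).

    The step back to [Delta] is where affine independence enters.  A point of
    [L_{T_i}] is an affine combination of the [p sigma] with [A i] a vertex of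
    [sigma] ([affine_hull_sub_flat]).  For a point common to several of these
    hulls, uniqueness of barycentric coordinates ([barycentric_unique]) makes
    all these combinations the same one.  Its coefficients sum to 1, so one of
    them, say that of [sigma], is nonzero; then [sigma] has every [A i],
    [i \in s], as a vertex, and the [A i] span a face of [sigma]
    ([simplex_of_nerve_span]). *)

Set Implicit Arguments.
Unset Strict Implicit.
Unset Printing Implicit Defensive.

Import Order.TTheory GRing.Theory Num.Theory.

Local Open Scope ring_scope.
Local Open Scope classical_set_scope.

Section Flats.
Variables (R : realType) (L : lmodType R) (I : finType) (p : I -> L).

(** The affine hull of [p @` J], with coefficients indexed by all of [I] so
    that combinations supported on different [J] can be compared. *)
Definition flat (J : set I) : set L :=
  [set x | exists c : I -> R,
    [/\ \sum_j c j = 1, forall j, ~ J j -> c j = 0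
      & x = \sum_j c j *: p j]].

Lemma point_in_flat (J : set I) : p @` J `<=` flat J.
Proof.
move=> _ [k Jk <-]; exists (fun j => (j == k)%:R); split.
- by rewrite (bigD1 k) //= eqxx big1 ?addr0 // => j /negPf ->.
- by move=> j nJj; case: eqP => // jk; case: nJj; rewrite jk.
- rewrite (bigD1 k) //= eqxx scale1r big1 ?addr0 // => j /negPf ->.
  by rewrite scale0r.
Qed.

(** An affine combination of affine combinations is one: multiply out and
    exchange the two sums. *)
Lemma affine_hull_sub_flat (J : set I) (S : set L) :
  S `<=` flat J -> affine_hull S `<=` flat J.
Proof.
move=> SJ x [n [a [y [Sy a1 ->]]]].
have /choice [c cP] : forall i, exists c : I -> R,
    [/\ \sum_j c j = 1, forall j, ~ J j -> c j = 0
      & y i = \sum_j c j *: p j] by move=> i; exact/SJ/Sy.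
exists (fun j => \sum_i a i * c i j); split.
- rewrite exchange_big /= -[RHS]a1; apply: eq_bigr => i _.
  by rewrite -mulr_sumr; have [-> _ _] := cP i; rewrite mulr1.
- move=> j nJj; apply: big1 => i _.
  by have [_ /(_ j nJj) -> _] := cP i; rewrite mulr0.
- under [RHS]eq_bigr do rewrite scaler_suml.
  rewrite exchange_big /=; apply: eq_bigr => i _.
  have [_ _ ->] := cP i; rewrite scaler_sumr.
  by apply: eq_bigr => j _; rewrite scalerA.
Qed.

Lemma barycentric_unique (c d : I -> R) : affinely_independent p ->
  \sum_j c j = \sum_j d j -> \sum_j c j *: p j = \sum_j d j *: p j ->
  c =1 d.
Proof.
move=> indp cd cpdp j; apply/eqP; rewrite -subr_eq0; apply/eqP.
apply: (indp (fun j => c j - d j)); first by rewrite sumrB cd subrr.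
by under eq_bigr do rewrite scalerBl; rewrite sumrB cpdp subrr.
Qed.

End Flats.

Lemma convex_hull_sub_affine_hull (R : realType) (L : lmodType R) (S : set L) :
  convex_hull S `<=` affine_hull S.
Proof. by move=> x [n [c [y [Sy _ c1 ->]]]]; exists n, c, y. Qed.

Section Nerves.
Variables (R : realType) (L : lmodType R) (K : simplicial_complex).
Variables (N : nat) (A : 'I_N -> vertex K) (p : vertex (barycentric K) -> L).

Lemma face_span_sub_flat (i : 'I_N) :
  face_span p A i `<=` flat p (star (A i)).
Proof.
apply: affine_hull_sub_flat.
apply: subset_trans (@convex_hull_sub_affine_hull _ _ _) _.
exact/affine_hull_sub_flat/point_in_flat.
Qed.

(** The barycenter of the simplex spanned by the [A i] is a common vertex of
    the faces [T_i]. *)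
Lemma nerve_face_of_simplex (s : {set 'I_N}) :
  A @: s \in simplices K -> s \in simplices (nerve (face_covering p A)).
Proof.
move=> As; rewrite /= inE; apply/andP; split.
  apply: contraTneq As => ->; rewrite imset0; exact: simplices_neq0.
apply/asboolP; exists (p (exist _ (A @: s) As)) => i /= si.
apply: sub_convex_hull; eexists; last by reflexivity.
by rewrite /star /=; apply: imset_f.
Qed.

Lemma nerve_span_of_face (s : {set 'I_N}) :
  s \in simplices (nerve (face_covering p A)) ->
  s \in simplices (nerve (span_covering p A)).
Proof.
rewrite /= !inE => /andP[-> /asboolP[x Fx]] /=; apply/asboolP; exists x.
by move=> i /Fx; exact: sub_affine_hull.
Qed.

(** A nonzero barycentric coordinate of a common point of the hulls belongs to
    a simplex [sigma] lying in the star of each [A i], hence having all of them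
    as vertices. *)
Lemma simplex_of_nerve_span (s : {set 'I_N}) : affinely_independent p ->
  s \in simplices (nerve (span_covering p A)) -> A @: s \in simplices K.
Proof.
move=> indp; rewrite /= inE => /andP[/set0Pn[i0 si0] /asboolP[x Fx]].
have [c [c1 _ xc]] := face_span_sub_flat (Fx i0 si0).
have [sigma csigma] : exists sigma, c sigma != 0.
  apply: contrapT => /forallNP c0; have /eqP := c1; rewrite big1.
    by rewrite eq_sym oner_eq0.
  by move=> j _; apply/eqP/negPn/negP/c0.
apply: (@simplices_down K _ (val sigma)) (valP sigma).
  by apply/set0Pn; exists (A i0); apply: imset_f.
apply/fintype.subsetP => _ /imsetP[i si ->].
have [d [d1 d0 xd]] := face_span_sub_flat (Fx i si).
apply: contrapT => nsi; move/eqP: csigma; apply.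
rewrite (barycentric_unique (d := d) indp) ?c1 ?d1 -?xc //.
exact: d0.
Qed.

End Nerves.

(* The three maps are T_i |-> L_{T_i}, T_i |-> A_i and L_{T_i} |-> A_i. *)
Theorem theorem4p4 (R : realType) (L : lmodType R) (Delta : simplicial_complex)
  (N : nat) (A : 'I_N -> vertex Delta) (bijA : bijective A)
  (p : vertex (barycentric Delta) -> L) (indp : affinely_independent p) :
  [/\ @simplicial_iso (nerve (face_covering p A)) (nerve (span_covering p A))
        (fun i : 'I_N => i),
      @simplicial_iso (nerve (face_covering p A)) Delta A
    & @simplicial_iso (nerve (span_covering p A)) Delta A].
Proof.
have FS s := @nerve_span_of_face _ _ _ _ A p s.
have SD s := @simplex_of_nerve_span _ _ _ _ A p s indp.
have DF s := @nerve_face_of_simplex _ _ _ _ A p s.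
split; split=> //.
- by exists id.
- by move=> s; rewrite imset_id; apply/idP/idP => [/FS|/SD/DF].
- by move=> s; apply/idP/idP => [/FS/SD|/DF].
- by move=> s; apply/idP/idP => [/SD|/DF/FS].
Qed.
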